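(* Let $D$ be a strongly connected digraph with minimum in-degree $\delta^-\ge 2$. Then $$\overrightarrow{\gamma}^{ID}(LD)\ge |A(D)|-|V(D)|.$$
   Context: Digraphs are finite, without loops or multiple arcs; digons (both arcs $(u,v)$ and $(v,u)$) are allowed. $V(D)$ and $A(D)$ are the vertex and arc sets. $N^-(u)$ and $N^+(u)$ are the in- and out-neighbourhoods, $N^-[u]=\{u\}\cup N^-(u)$, $N^+[u]=\{u\}\cup N^+(u)$. The line digraph $LD$ of $D$ has vertex set $A(D)$, and a vertex $uv$ (for the arc $(u,v)$) is adjacent to $wz$ if and only if $v=w$. An identifying code of a digraph $G$ is a set $C\subseteq V(G)$ that is dominating ($\bigcup_{c\in C}N^+[c]=V(G)$) and such that $N^-[x]\cap C\ne N^-[y]\cap C$ for all distinct $x,y\in V(G)$. $\overrightarrow{\gamma}^{ID}(G)$ denotes the minimum size of an identifying code of $G$. *)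

(* Defs.v *)
From HB Require Import structures.
From mathcomp Require Import all_boot.

Set Implicit Arguments.
Unset Strict Implicit.
Unset Printing Implicit Defensive.

(* The arc relation is directed and [rel]-valued, so multiple arcs are excluded
   and digons are allowed. *)
Record digraph := Digraph {
  vertex :> finType;
  arc : rel vertex;
  arc_irr : irreflexive arc
}.

Definition arcs (D : digraph) : {set D * D} := [set p | arc p.1 p.2].

Definition in_nbh (D : digraph) (u : D) : {set D} := [set v | arc v u].
Definition out_nbh (D : digraph) (u : D) : {set D} := [set v | arc u v].
Definition cin_nbh (D : digraph) (u : D) : {set D} := u |: in_nbh u.
Definition cout_nbh (D : digraph) (u : D) : {set D} := u |: out_nbh u.

(* Every in-degree is smaller than #|D|, so the initial value #|D| is never the
   minimum unless D has no vertices, in which case the result is 0. *)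
Definition min_indegree (D : digraph) : nat :=
  \big[minn/#|D|]_(u : D) #|in_nbh u|.

Definition strongly_connected (D : digraph) : Prop :=
  forall u v : D, connect (@arc D) u v.

Section LineDigraph.
Variable D : digraph.

Definition line_vertex : finType := {p : D * D | p \in arcs D}.

Definition line_arc : rel line_vertex :=
  [rel a b | (val a).2 == (val b).1].

Lemma line_arc_irr : irreflexive line_arc.
Proof.
case=> [[u v] /= uvD]; apply/eqP => /= vu; move: uvD.
by rewrite vu inE /= arc_irr.
Qed.

Definition line_digraph : digraph := Digraph line_arc_irr.

End LineDigraph.

Section IdentifyingCode.
Variable G : digraph.

Definition dominating (C : {set G}) : bool :=
  \bigcup_(c in C) cout_nbh c == [set: G].

Definition identifying_code (C : {set G}) : bool :=
  dominating C &&
  [forall x : G, forall y : G,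
     (x != y) ==> (cin_nbh x :&: C != cin_nbh y :&: C)].

(* A digraph in which two vertices have the same closed in-neighbourhood has no
   identifying code; the value is then 0, so that a positive lower bound on
   [id_number G] entails that G has an identifying code. *)
Definition id_number : nat :=
  if [pick C | identifying_code C] is Some C0
  then #|[arg min_(C < C0 | identifying_code C) #|C| ]|
  else 0.

End IdentifyingCode.

(* Main.v *)
Require Import Defs.
From HB Require Import structures.
From mathcomp Require Import all_boot.

(* Two distinct arcs with the same tail u have the same in-neighbours in the
   line digraph, namely the arcs entering u.  A code must therefore separate
   them by the arcs themselves, so it omits at most one arc leaving each
   vertex.  In-degree at least 2 guarantees that some code exists. *)

Lemma min_indegree_leq {D : digraph} (u : D) : min_indegree D <= #|in_nbh u|.
Proof.
rewrite /min_indegree; have := mem_index_enum u.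
elim: (index_enum D) => // v s IHs; rewrite in_cons big_cons geq_min.
by case/predU1P => [<- | /IHs ->]; rewrite ?leqnn ?orbT.
Qed.

Lemma mem_cin_nbh_line {D : digraph} (a b : line_digraph D) :
  (b \in cin_nbh a) = (b == a) || ((val b).2 == (val a).1).
Proof. by rewrite !inE. Qed.

Lemma line_cin_nbh_inj {D : digraph} :
  (forall u : D, 1 < #|in_nbh u|) ->
  injective (@cin_nbh (line_digraph D)).
Proof.
move=> deg a b eqN; apply/eqP/negPn/negP => neq_ab.
(* Since [a] belongs to its own closed in-neighbourhood, it is an in-neighbour of [b]: the head of
   [a] is the tail of [b]. *)
have := mem_cin_nbh_line a a; rewrite eqxx eqN mem_cin_nbh_line (negPf neq_ab) /=.
move/eqP => ab.
(* An in-neighbour of the tail of a, other than the tail of b, gives an arc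
   of the line digraph entering a but not b. *)
have [x xa xb] : exists2 x, x \in in_nbh (val a).1 & x != (val b).1.
  have /card_gt1P[x [y [xa ya xy]]] := deg (val a).1.
  case: (eqVneq x (val b).1) => [xb | ]; last by exists x.
  by exists y; rewrite // -xb eq_sym.
have xD : (x, (val a).1) \in arcs D by move: xa; rewrite !inE.
pose c : line_digraph D := Sub (x, (val a).1) xD.
have := mem_cin_nbh_line a c; rewrite eqN mem_cin_nbh_line eqxx orbT /=.
(* The case [c = b] contradicts the choice of [x]; equal tails would, by [ab], make [a] a loop. *)
case/orP => [/eqP cb | /eqP a1b1].
  by move: xb; rewrite -cb eqxx.
by have := valP a; rewrite inE ab -a1b1 arc_irr.
Qed.

Lemma identifying_code_setT {G : digraph} :
  injective (@cin_nbh G) -> identifying_code [set: G].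
Proof.
move=> injN; apply/andP; split.
  apply/eqP/setP => x; rewrite inE; apply/bigcupP; exists x; first exact: in_setT.
  exact: setU11.
by apply/forallP => x; apply/forallP => y; rewrite !setIT (inj_eq injN) implybb.
Qed.

(** A known code rules out the default value 0, so the minimum is attained. *)
Lemma id_number_code {G : digraph} (C0 : {set G}) :
  identifying_code C0 ->
  exists2 C : {set G}, identifying_code C & id_number G = #|C|.
Proof.
rewrite /id_number => codeC0; case: pickP => [C1 codeC1 | /(_ C0)].
  by case: arg_minnP => // C codeC _; exists C.
by rewrite codeC0.
Qed.

Lemma tail_inj_setC {D : digraph} (C : {set line_digraph D}) :
  identifying_code C ->
  {in ~: C &, injective (fun a : line_digraph D => (val a).1)}.
Proof.
case/andP => _ /forallP sepC a b; rewrite !inE => aC bC eq_tail.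
apply/eqP; apply: contraT => neq_ab.
have /forallP/(_ b)/implyP/(_ neq_ab)/eqP[] := sepC a.
apply/setP => c; rewrite !in_setI !mem_cin_nbh_line eq_tail.
have [cC | _] := boolP (c \in C); last by rewrite !andbF.
have /negPf-> : c != a by apply: contraNneq aC => <-.
by have /negPf-> : c != b by apply: contraNneq bC => <-.
Qed.

Lemma card_line_digraph (D : digraph) : #|line_digraph D| = #|arcs D|.
Proof. exact: card_sig. Qed.

Theorem theorem3p1 (D : digraph)
  (hconn : strongly_connected D)
  (hdeg : 2 <= min_indegree D) :
  #|arcs D| - #|D| <= id_number (line_digraph D).
Proof.
have deg (u : D) : 1 < #|in_nbh u| := leq_trans hdeg (min_indegree_leq u).
have [C codeC ->] :=
  id_number_code _ (identifying_code_setT (line_cin_nbh_inj deg)).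
(* Splitting the arcs into [C] and its complement leaves [#|~: C| <= #|D|], which holds because
   tails embed the complement into the vertices. *)
rewrite leq_subLR -card_line_digraph -(cardsC C) addnC leq_add2r.
by rewrite -(card_in_imset (tail_inj_setC C codeC)) max_card.
Qed.
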